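(* Let $N$ be a Poisson process on $[0,\infty)$ with intensity $\lambda>0$, with points $0<X_1<X_2<\cdots$, and let $\epsilon>0$. For $n\ge0$ let $p_n(x)=\Pr(\beta_0(x)=n)$, $x\ge0$. Then for every integer $n\ge 0$ and every $s>0$, $$\int_0^\infty e^{-sx}p_n(x)\,dx=\frac{\lambda^n\, e^{(\lambda+s)\epsilon}}{\left(s\,e^{(\lambda+s)\epsilon}+\lambda\right)^{n+1}}.$$
   Context: A cluster is a maximal set of consecutive points $X_j,\dots,X_k$ with $X_{l+1}-X_l\le\epsilon$ for $j\le l<k$. Clusters are numbered from left to right; the end of the $i$-th cluster is $E_i=X_k+\epsilon$, where $X_k$ is its last point. The number of (complete) clusters in $[0,x]$ is $\beta_0(x)=\#\{i\ge1: E_i\le x\}$. *)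

(* Defs.v *)
From HB Require Import structures.
From mathcomp Require Import all_boot all_order all_algebra.
From mathcomp Require Import all_classical all_reals all_analysis.
Set Implicit Arguments. Unset Strict Implicit. Unset Printing Implicit Defensive.
Import Order.TTheory GRing.Theory Num.Theory.
Local Open Scope classical_set_scope.
Local Open Scope ring_scope.

(* Convention: X 0 = 0 is the origin (not a point); X k, k >= 1, is the k-th
   point X_k of the process (X_1 < X_2 < ...). *)

Definition gap {T} {R : realType} (X : nat -> T -> R) (k : nat) : T -> R :=
  fun w => X k.+1 w - X k w.

Definition mutually_independent {d} {T : measurableType d} {R : realType}
    (P : probability T R) (Y : nat -> T -> R) : Prop :=
  forall (I : seq nat) (B : nat -> set R), uniq I ->
    (forall i, measurable (B i)) ->
    P (\bigcap_(i in [set i | i \in I]) (Y i @^-1` B i)) =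
    \big[*%E/1%E]_(i <- I) P (Y i @^-1` B i).

Definition poisson_process_points {d} {T : measurableType d} {R : realType}
    (P : probability T R) (lam : R) (X : nat -> T -> R) : Prop :=
  [/\ forall w, X 0%N w = 0,
      forall k, measurable_fun setT (X k),
      mutually_independent P (gap X) &
      forall k (A : set R), measurable A ->
        P (gap X k @^-1` A) = exponential_prob lam A].

(* X_k (k >= 1) is the last point of its cluster iff X_{k+1} - X_k > eps;
   the end of that cluster is E = X_k + eps.  Clusters are numbered left to
   right, so the cluster ends are in bijection with these indices k, and
   beta0(x) = #{i >= 1 : E_i <= x} = #{k >= 1 : X_k last of its cluster,
   X_k + eps <= x}. *)
Definition is_cluster_end_index {T} {R : realType} (X : nat -> T -> R)
    (eps x : R) (w : T) (k : nat) : Prop :=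
  [/\ (1 <= k)%N, eps < X k.+1 w - X k w & X k w + eps <= x].

Definition beta0_eq {T} {R : realType} (X : nat -> T -> R) (eps x : R)
    (n : nat) : set T :=
  [set w | exists s : seq nat, [/\ uniq s, size s = n &
           forall k, k \in s <-> is_cluster_end_index X eps x w k]].

(* Main.v *)
Require Import Defs.
From HB Require Import structures.
From mathcomp Require Import all_boot all_order all_algebra.
From mathcomp Require Import all_classical all_reals all_analysis.
From mathcomp Require Import measurable_realfun ring lra.
Set Implicit Arguments. Unset Strict Implicit. Unset Printing Implicit Defensive.
Import Order.TTheory GRing.Theory Num.Theory.
Local Open Scope classical_set_scope.
Local Open Scope ring_scope.

(* Almost surely, exactly one of the following holds for x >= 0: either x < eps,
   and then beta0(x) = 0, or X_m + eps <= x < X_(m+1) + eps for a unique m >= 0,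
   and then beta0(x) is the number of k in 1..m with X_(k+1) - X_k > eps.
   Integrating e^(-s x) over each of these intervals (Tonelli) turns the Laplace
   transform of p_n into a series over m of differences of expectations of
   e^(-s X_m) 1{count = n}.  Since the gaps are i.i.d. exponential, these
   expectations satisfy a linear recursion in (m, n), with weights
     lam/(lam+s) (1 - e^(-(lam+s) eps))  and  lam/(lam+s) e^(-(lam+s) eps)
   for a gap <= eps and > eps respectively; summing the recursion over m gives a
   first-order recursion in n, hence the geometric dependence on n. *)

(** * Integration *)

Lemma measurable_natr_bool d (T : measurableType d) (R : realType) (b : T -> bool) :
  measurable_fun setT b -> measurable_fun setT (fun x => (b x)%:R : R).
Proof.
move=> mb; rewrite (_ : (fun x => _) = fun x => if b x then 1 else 0).
  exact: measurable_fun_ifT.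
by apply/funext => x; case: (b x).
Qed.

Lemma measurable_set_bool d (T : measurableType d) (b : T -> bool) :
  measurable_fun setT b -> measurable [set w | b w].
Proof. by move=> mb; rewrite -[X in measurable X]setTI; exact: mb. Qed.

Lemma measure_setD_null d (T : measurableType d) (R : realType)
    (mu : {measure set T -> \bar R}) (A N : set T) :
  measurable A -> measurable N -> mu N = 0%E -> mu A = mu (A `\` N).
Proof.
move=> mA mN N0; rewrite (measureDI mu mA mN).
rewrite [X in (_ + X)%E](_ : _ = 0%E) ?adde0//.
by apply: subset_measure0 N0 => //; exact: measurableI.
Qed.

(** * Change of variables with a weight *)

Section density.
Context d1 d2 (T : measurableType d1) (S : measurableType d2) (R : realType).
Variables (m : {measure set T -> \bar R}) (nu : {measure set S -> \bar R}).
Variables (phi : T -> S) (w : T -> R) (c : R) (D : set T).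
Hypotheses (mD : measurable D) (mphi : measurable_fun setT phi).
Hypotheses (mw : measurable_fun setT w) (w_ge0 : forall x, 0 <= w x).
Hypothesis phi_w_nu : forall B, measurable B ->
  (\int[m]_(x in D `&` phi @^-1` B) (w x)%:E = c%:E * nu B)%E.

Import HBNNSimple.

(** The hypothesis [phi_w_nu] is the case of indicators; linearity gives simple functions, and
    monotone convergence gives nonnegative measurable ones. It serves both to split off one
    independent variable, the others forming the weight, and to integrate against a density. *)
Lemma ge0_integral_comp_density (f : S -> R) :
  measurable_fun setT f -> (forall y, 0 <= f y) ->
  (\int[m]_(x in D) (f (phi x) * w x)%:E = c%:E * \int[nu]_y (f y)%:E)%E.
Proof.
move=> mf f0; have mEf : measurable_fun setT (EFin \o f) by exact/measurable_EFinP.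
pose h := nnsfun_approx measurableT mEf.
have h_cvg y : EFin \o h ^~ y @ \oo --> (f y)%:E.
  by apply: (cvg_nnsfun_approx measurableT mEf) => // z _; rewrite lee_fin.
have h_nd y : {homo (fun n => (h n y)) : a b / (a <= b)%N >-> a <= b}.
  by move=> a b ab; exact/lefP/(nd_nnsfun_approx measurableT mEf).
have mhphi n : measurable_fun D (h n \o phi).
  by apply: measurable_funTS; exact: measurableT_comp.
have mwD : measurable_fun D w by exact: measurable_funTS.
have -> : (\int[nu]_y (f y)%:E = limn (fun n => \int[nu]_y (h n y)%:E))%E.
  rewrite -monotone_convergence//.
  - by apply: eq_integral => y _; apply/esym/cvg_lim => //; exact: h_cvg.
  - by move=> n; exact/measurable_EFinP.
  - by move=> n y _; rewrite lee_fin.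
  - by move=> y _ a b ab; rewrite lee_fin h_nd.
have -> : (\int[m]_(x in D) (f (phi x) * w x)%:E =
    limn (fun n => \int[m]_(x in D) (h n (phi x) * w x)%:E))%E.
  rewrite -monotone_convergence//.
  - apply: eq_integral => x _; apply/esym/cvg_lim => //.
    under eq_fun do rewrite EFinM.
    by rewrite EFinM; apply: cvgeZr => //; exact: h_cvg.
  - by move=> n; apply/measurable_EFinP; exact: (measurable_funM (mhphi n) mwD).
  - by move=> n y _; rewrite lee_fin mulr_ge0.
  - by move=> y _ a b ab; rewrite lee_fin ler_wpM2r// h_nd.
rewrite -limeMl//; last first.
  apply: ereal_nondecreasing_is_cvgn => a b ab; apply: ge0_le_integral => //.
  - by move=> y _; rewrite lee_fin.
  - exact/measurable_EFinP.
  - exact/measurable_EFinP.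
  - by move=> y _; rewrite lee_fin h_nd.
congr (lim (_ @ \oo)); apply/funext => n.
have mpre r : measurable (phi @^-1` (h n @^-1` [set r])).
  by rewrite -[X in measurable X]setTI; exact: mphi.
transitivity (\int[m]_(x in D) \sum_(r \in range (h n))
    (r * (\1_(phi @^-1` (h n @^-1` [set r])) x * w x))%:E)%E.
  apply: eq_integral => x _; rewrite (fimfunE (h n) (phi x)) fsumEFin//.
  congr EFin; rewrite mulrC.
  rewrite mulr_fsumr; apply: eq_fsbigr => r _.
  by rewrite mulrC mulrA.
rewrite ge0_integral_fsum//; last 2 first.
- by move=> r; apply/measurable_EFinP; do 2 apply: measurable_funM => //.
- move=> r x _; rewrite lee_fin; have [/= hr|hr] := eqVneq (h n (phi x)) r.
    by rewrite mulr_ge0 -?hr// mulr_ge0.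
  by rewrite indicE memNset ?mul0r ?mulr0//= => hr'; rewrite hr' eqxx in hr.
rewrite integralT_nnsfun sintegralE ge0_mule_fsumr; last exact: nnsfun_mulemu_ge0.
apply: eq_fsbigr => r /[!inE] -[y _ hyr].
have r0 : 0 <= r by rewrite -hyr.
under eq_integral do rewrite EFinM.
rewrite ge0_integralZl//.
- rewrite muleCA -phi_w_nu// integral_mkcondr; congr (_ * _)%E.
  apply: eq_integral => x _; rewrite /patch indicE.
  by case: ifPn => _; rewrite ?mul1r ?mul0r.
- apply/measurable_EFinP; apply: (measurable_funM _ mwD).
  exact: measurable_indic.
- by move=> x _; rewrite lee_fin mulr_ge0.
Qed.
End density.

(** * Expectations of products of independent variables *)

Section independence.
Context d (T : measurableType d) (R : realType) (P : probability T R).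
Variables (Y : nat -> T -> R) (nu : {measure set (measurableTypeR R) -> \bar R}).
Hypotheses (mY : forall k, measurable_fun setT (Y k)).
Hypothesis indepY : mutually_independent P Y.
Hypothesis distY : forall k (A : set R), measurable A -> P (Y k @^-1` A) = nu A.

Let measurable_preimageY k (A : set R) : measurable A -> measurable (Y k @^-1` A).
Proof. by move=> mA; rewrite -[X in measurable X]setTI; exact: mY. Qed.

Lemma prob_bigcap_indep (J : seq nat) (B : nat -> set R) :
  uniq J -> (forall j, measurable (B j)) ->
  P (\bigcap_(j in [set j | j \in J]) (Y j @^-1` B j)) =
  \big[*%E/1%E]_(j <- J) nu (B j).
Proof.
move=> uJ mB; have /= -> := indepY uJ mB.
by apply: eq_bigr => j _; exact: distY.
Qed.

(* Functions are traded for indicators of sets one index at a time, down to the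
   product rule for sets. *)
Lemma integral_prod_indep_on (I J : seq nat) (f : nat -> R -> R) (e : nat -> R)
    (B : nat -> set R) : uniq (I ++ J) ->
  (forall i, measurable_fun setT (f i)) -> (forall i x, 0 <= f i x) ->
  (forall i, i \in I -> (\int[nu]_x (f i x)%:E = (e i)%:E)%E) ->
  (forall j, measurable (B j)) ->
  (\int[P]_(w in \bigcap_(j in [set j | j \in J]) (Y j @^-1` B j))
     (\prod_(i <- I) f i (Y i w))%:E =
   (\prod_(i <- I) e i)%:E * \big[*%E/1%E]_(j <- J) nu (B j))%E.
Proof.
move=> + mf f0 + mB; elim: I J B mB => [|i I IH] J B mB uIJ fe.
  under eq_integral do rewrite big_nil.
  rewrite integral_cst; last first.
    by apply: bigcap_measurableType => j _; exact: measurable_preimageY.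
  by rewrite big_nil !mul1e; exact: prob_bigcap_indep.
set D := \bigcap_(j in _) _.
have mD : measurable D.
  by apply: bigcap_measurableType => j _; exact: measurable_preimageY.
have uJ : uniq J by move: uIJ; rewrite cat_uniq => /and3P[].
have nuJ : \big[*%E/1%E]_(j <- J) nu (B j) = P D.
  by rewrite /D prob_bigcap_indep.
have fe' j : j \in I -> (\int[nu]_x (f j x)%:E = (e j)%:E)%E.
  by move=> jI; apply: fe; rewrite inE jI orbT.
have [iJ uIJ'] : i \notin I ++ J /\ uniq (I ++ J) by move: uIJ => /= /andP[].
under eq_integral do rewrite big_cons.
(* The weight is the product over the remaining indices. The constant [c] is its integral over [D],
   written with [fine (P D)] because it has to be a real number. *)
rewrite (ge0_integral_comp_density (nu := nu) (phi := Y i)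
  (c := (\prod_(j <- I) e j) * fine (P D)) mD)//.
- rewrite fe ?inE ?eqxx// nuJ big_cons -EFinM.
  by rewrite -[in RHS](@fineK _ (P D)) ?fin_num_measure// -EFinM mulrC mulrA.
- exact: mY.
- by apply: measurable_prod => j _; exact: (measurableT_comp (mf j) (mY j)).
- by move=> w; apply: prodr_ge0.
2: exact: mf.
move=> B0 mB0.
(* The index [i] joins the set constraints [J], with [B0] as its set, and the induction hypothesis
   applies to [i :: J]. *)
pose B' j := if j == i then B0 else B j.
have -> : D `&` Y i @^-1` B0 = \bigcap_(j in [set j | j \in i :: J]) (Y j @^-1` B' j).
  apply/seteqP; split=> [w [Dw Bw] j /=|w Dw].
    rewrite inE /B'; have [->//|ji /=] := eqVneq j i.
    by move=> jJ; exact: Dw.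
  split; last by have := Dw i (mem_head _ _); rewrite /B' eqxx.
  move=> j /= jJ; have := Dw j; rewrite /= inE jJ orbT => /(_ isT).
  rewrite /B'; have [ji|//] := eqVneq j i.
  by move: iJ; rewrite mem_cat -ji jJ orbT.
rewrite IH//.
- rewrite big_cons /B' eqxx EFinM -[in RHS]muleA; congr (_ * _)%E.
  rewrite fineK ?fin_num_measure// -nuJ muleC; congr (_ * _)%E.
  rewrite big_seq [in RHS]big_seq; apply: eq_bigr => j jJ.
  by have [ji|//] := eqVneq j i; move: iJ; rewrite mem_cat -ji jJ orbT.
- by move=> j; rewrite /B'; case: ifP.
- by rewrite -cat1s uniq_catCA cat1s.
Qed.

Lemma integral_prod_indep (I : seq nat) (f : nat -> R -> R) (e : nat -> R) :
  uniq I ->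
  (forall i, measurable_fun setT (f i)) -> (forall i x, 0 <= f i x) ->
  (forall i, i \in I -> (\int[nu]_x (f i x)%:E = (e i)%:E)%E) ->
  (\int[P]_w (\prod_(i <- I) f i (Y i w))%:E = (\prod_(i <- I) e i)%:E)%E.
Proof.
move=> uI mf f0 fe.
have := @integral_prod_indep_on I [::] f e (fun=> setT).
rewrite cats0 big_nil mule1 => <- //; congr (integral _ _ _).
by apply/seteqP; split.
Qed.

End independence.

(** * Integrals against the exponential law *)

Section exponential.
Context (R : realType) (lam : R).
Hypothesis lam_gt0 : 0 < lam.

(* [exponential_prob lam] is a measure only if [0 < lam]: its measure structure takes
   that proof as an argument, which canonical inference cannot find. *)
Definition exponential_measure : {measure set (measurableTypeR R) -> \bar R} :=
  exponential_distribution_exponential_prob__canonical__measure_function_Measure lam_gt0.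

Notation mu := exponential_measure.

Lemma integral_exponential_measure (f : R -> R) :
  measurable_fun setT f -> (forall x, 0 <= f x) ->
  (\int[mu]_x (f x)%:E =
   \int[lebesgue_measure]_x (f x * exponential_pdf lam x)%:E)%E.
Proof.
move=> mf f0.
rewrite (ge0_integral_comp_density (T := measurableTypeR R) (phi := idfun)
  (w := exponential_pdf lam) (c := 1) (nu := mu))//.
- by rewrite mul1e.
- exact: measurable_id.
- exact: (measurable_exponential_pdf lam).
- by move=> x; exact/exponential_pdf_ge0/ltW.
- by move=> B mB; rewrite mul1e setTI.
Qed.

Lemma measurable_expRM (c : R) : measurable_fun setT (fun x : R => expR (c * x)).
Proof.
by apply: measurableT_comp => //; exact: mulrl_measurable.
Qed.

(** Exponential tilting: it reduces integrals with a factor e^(-s x) to total masses or tails at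
    rate lam + s. *)
Lemma exponential_pdfM (s x : R) : 0 <= s ->
  expR (- s * x) * exponential_pdf lam x =
  lam / (lam + s) * exponential_pdf (lam + s) x.
Proof.
move=> s0; have ls : lam + s != 0 by rewrite gt_eqF// ltr_wpDr.
rewrite /exponential_pdf !patchE; case: ifPn => _; last by rewrite !mulr0.
have -> : - (lam + s) * x = - s * x + - lam * x by ring.
by rewrite expRD; field.
Qed.

Lemma exponential_laplace (s : R) : 0 <= s ->
  (\int[mu]_x (expR (- s * x))%:E = (lam / (lam + s))%:E)%E.
Proof.
move=> s0; have ls : 0 < lam + s by rewrite ltr_wpDr.
rewrite integral_exponential_measure//; last exact: measurable_expRM.
under eq_integral do rewrite exponential_pdfM// EFinM.
rewrite ge0_integralZl//=.
- by rewrite integral_exponential_pdf// mule1.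
- by apply/measurable_EFinP; exact: measurable_exponential_pdf.
- by move=> x _; rewrite lee_fin exponential_pdf_ge0// ltW.
- by rewrite lee_fin divr_ge0// ltW.
Qed.

(** The tail and the mass of [0, t] add up to 1, and the latter is known and finite, so it can be
    subtracted. *)
Lemma integral_exponential_pdf_tail (r t : R) : 0 < r -> 0 < t ->
  (\int[lebesgue_measure]_x ((t < x)%R%:R * exponential_pdf r x)%:E =
   (expR (- r * t))%:E)%E.
Proof.
move=> r0 t0.
have mpdf : measurable_fun setT (exponential_pdf r) by exact: measurable_exponential_pdf.
have pdf0 x : 0 <= exponential_pdf r x by rewrite exponential_pdf_ge0// ltW.
have mlt : measurable_fun setT (fun x : R => (t < x)%R%:R : R).
  apply: measurable_natr_bool.
  exact: measurable_fun_ltr.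
have : (\int[lebesgue_measure]_x (((t < x)%R%:R * exponential_pdf r x)%:E +
    ((x <= t)%R%:R * exponential_pdf r x)%:E) = 1)%E.
  rewrite -(integral_exponential_pdf r0); apply: eq_integral => x _.
  by rewrite -EFinD -mulrDl ltNge; case: (x <= t); rewrite ?addr0 ?add0r mul1r.
have mle : measurable_fun setT (fun x : R => (x <= t)%R%:R : R).
  apply: measurable_natr_bool.
  exact: measurable_fun_ler.
rewrite ge0_integralD//; last 4 first.
- by move=> x _; rewrite lee_fin mulr_ge0.
- by apply/measurable_EFinP; exact: (measurable_funM mlt mpdf).
- by move=> x _; rewrite lee_fin mulr_ge0.
- by apply/measurable_EFinP; exact: (measurable_funM mle mpdf).
have -> : (\int[lebesgue_measure]_x ((x <= t)%R%:R * exponential_pdf r x)%:E =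
    1 - (expR (- r * t))%:E)%E.
  rewrite -exponential_prob_itv0c// /exponential_prob [RHS]integral_mkcond.
  apply: eq_integral => x _; rewrite patchE; case: ifPn.
    by rewrite inE/= in_itv/= => /andP[_ ->]; rewrite mul1r.
  rewrite notin_setE/= in_itv/= => xt; congr EFin.
  have [x0|x0] := ltP x 0; first by rewrite lt0_exponential_pdf// mulr0.
  by move: xt; rewrite x0/=; case: (x <= t) => //; rewrite mul0r.
rewrite -EFinB => h; set q := expR _ in h *.
by rewrite -[LHS](@addeK _ (1 - q)%:E)// h -EFinB; congr EFin; ring.
Qed.

(** A difference of integrals, phrased through the sum [f + g] so that only nonnegative functions
    occur. *)
Lemma integral_addr_subl (f g : R -> R) (a b : R) :
  measurable_fun setT f -> (forall x, 0 <= f x) ->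
  measurable_fun setT g -> (forall x, 0 <= g x) ->
  (\int[mu]_x (f x)%:E = a%:E)%E -> (\int[mu]_x (f x + g x)%:E = b%:E)%E ->
  (\int[mu]_x (g x)%:E = (b - a)%:E)%E.
Proof.
move=> mf f0 mg g0 fa.
under eq_integral do rewrite EFinD.
rewrite ge0_integralD//; last 4 first.
- by move=> x _; rewrite lee_fin.
- exact/measurable_EFinP.
- by move=> x _; rewrite lee_fin.
- exact/measurable_EFinP.
by rewrite fa addeC EFinB => <-; rewrite addeK.
Qed.

(* The gap of index 0, from the origin to the first point, never ends a cluster:
   hence the factors [0 < m]. *)
Definition tail_kernel (s eps : R) (j : bool) (m : nat) (x : R) : R :=
  expR (- s * x) * (((0 < m)%N && (eps < x)) == j)%:R.

(** The integral of [tail_kernel]. Here [q] is the probability, at the tilted rate lam + s, that gap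
    [m] ends a cluster. *)
Definition tail_weight (s eps : R) (j : bool) (m : nat) : R :=
  let q := (0 < m)%N%:R * expR (- (lam + s) * eps) in
  lam / (lam + s) * (if j then q else 1 - q).

Lemma tail_kernel_ge0 s eps j m x : 0 <= tail_kernel s eps j m x.
Proof. by rewrite mulr_ge0// expR_ge0. Qed.

Lemma measurable_tail_kernel s eps j m : measurable_fun setT (tail_kernel s eps j m).
Proof.
apply: measurable_funM; first exact: measurable_expRM.
apply: measurable_natr_bool.
case: m => [|m] //=; case: j => //=.
- under eq_fun do rewrite eqb_id; exact: measurable_fun_ltr.
- under eq_fun do rewrite eqbF_neg -leNgt; exact: measurable_fun_ler.
Qed.

Lemma integral_tail_kernel (s eps : R) j m : 0 <= s -> 0 < eps ->
  (\int[mu]_x (tail_kernel s eps j m x)%:E = (tail_weight s eps j m)%:E)%E.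
Proof.
move=> s0 eps0; have ls : 0 < lam + s by rewrite ltr_wpDr.
have tailT k : (\int[mu]_x (tail_kernel s eps true k x)%:E =
    (tail_weight s eps true k)%:E)%E.
  case: k => [|k].
    rewrite /tail_weight/= mul0r mulr0; apply: (@integral0_eq _ _ _ mu) => x _.
    by rewrite /tail_kernel/= mulr0.
  rewrite /tail_weight/= mul1r EFinM -integral_exponential_pdf_tail//.
  rewrite integral_exponential_measure; last 2 first.
  - exact: measurable_tail_kernel.
  - exact: tail_kernel_ge0.
  rewrite -ge0_integralZl//=; last 3 first.
  - apply/measurable_EFinP; apply: measurable_funM => //; last first.
      exact: (measurable_exponential_pdf (lam + s)).
    apply: measurable_natr_bool.
    exact: measurable_fun_ltr.
  - by move=> x _; rewrite lee_fin mulr_ge0// exponential_pdf_ge0// ltW.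
  - by rewrite lee_fin divr_ge0// ltW.
  apply: eq_integral => x _; rewrite /tail_kernel /= eqb_id -EFinM.
  by congr EFin; rewrite [RHS]mulrCA -exponential_pdfM//; ring.
case: j; first exact: tailT.
(* The two kernels add up to e^(-s x), whose integral is lam / (lam + s); the case [false] follows
   by subtraction. *)
have -> : tail_weight s eps false m = lam / (lam + s) - tail_weight s eps true m.
  by rewrite /tail_weight; ring.
apply: (integral_addr_subl (f := tail_kernel s eps true m)) => //;
  do ?[exact: measurable_tail_kernel | exact: tail_kernel_ge0].
rewrite -exponential_laplace//; apply: eq_integral => x _; congr EFin.
by rewrite /tail_kernel -mulrDr; case: (_ && _); rewrite /= ?addr0 ?add0r mulr1.
Qed.
End exponential.

Lemma exponential_measure_le (R : realType) (lam t : R) (lam_gt0 : 0 < lam) : 0 < t ->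
  exponential_measure lam_gt0 [set x | x <= t] = (1 - expR (- lam * t))%:E.
Proof.
move=> t0; have mA : measurable [set x : R | x <= t].
  by apply: measurable_set_bool; exact: measurable_fun_ler.
rewrite -[X in exponential_measure _ X]setIT -integral_indic//.
(* At s = 0, m = 1 and [j = false] the kernel is the indicator of x <= t. *)
have := integral_tail_kernel lam_gt0 false 1 (lexx 0) t0.
rewrite /tail_weight/= mul1r addr0 divff ?gt_eqF// mul1r => <-.
apply: (eq_integral (mu := exponential_measure lam_gt0)) => x _.
rewrite /tail_kernel oppr0 mul0r expR0 mul1r indicE /= eqbF_neg -leNgt.
by congr (nat_of_bool _)%:R%:E; apply/idP/idP => [/set_mem|/mem_set].
Qed.

(** * Expectations of variables independent of the later gaps *)

Section past.
Context d (T : measurableType d) (R : realType) (P : probability T R).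
Variables (Y : nat -> T -> R) (nu : {measure set (measurableTypeR R) -> \bar R}).
Hypotheses (mY : forall k, measurable_fun setT (Y k)).
Hypothesis indepY : mutually_independent P Y.
Hypothesis distY : forall k (A : set R), measurable A -> P (Y k @^-1` A) = nu A.

(* [Z] has expectation [z] and is independent of the [Y i], [m <= i]; independence is
   expressed through the product rule for expectations, so that no sigma-algebra
   generated by the past is needed. *)
Definition past_expectation (m : nat) (Z : T -> R) (z : R) :=
  [/\ measurable_fun setT Z, (forall w, 0 <= Z w) &
   forall (I : seq nat) (f : nat -> R -> R) (e : nat -> R),
     uniq I -> (forall i, i \in I -> (m <= i)%N) ->
     (forall i, measurable_fun setT (f i)) -> (forall i x, 0 <= f i x) ->
     (forall i, i \in I -> (\int[nu]_x (f i x)%:E = (e i)%:E)%E) ->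
     (\int[P]_w (Z w * \prod_(i <- I) f i (Y i w))%:E =
      (z * \prod_(i <- I) e i)%:E)%E].

Lemma past_expectation_integral m Z z :
  past_expectation m Z z -> (\int[P]_w (Z w)%:E = z%:E)%E.
Proof.
move=> [mZ Z0 EZ].
have {}EZ := EZ [::] (fun=> cst 0) (fun=> 0) isT.
transitivity (z * \prod_(i <- [::] : seq nat) (0 : R))%:E; last by rewrite big_nil mulr1.
by rewrite -EZ//; apply: eq_integral => w _; rewrite big_nil mulr1.
Qed.

Lemma past_expectation_cst m (c : R) : 0 <= c -> past_expectation m (cst c) c.
Proof.
move=> c0; split=> // I f e uI _ mf f0 fe.
under eq_integral do rewrite /= EFinM.
rewrite ge0_integralZl//.
- by rewrite (integral_prod_indep mY indepY distY uI mf f0 fe).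
- apply/measurable_EFinP; apply: measurable_prod => i _.
  exact: (measurableT_comp (mf i) (mY i)).
- by move=> w _; rewrite lee_fin prodr_ge0.
Qed.

Lemma past_expectationD m Z1 z1 Z2 z2 :
  past_expectation m Z1 z1 -> past_expectation m Z2 z2 ->
  past_expectation m (fun w => Z1 w + Z2 w) (z1 + z2).
Proof.
move=> [mZ1 Z10 E1] [mZ2 Z20 E2]; split.
- exact: measurable_funD.
- by move=> w; rewrite addr_ge0.
move=> I f e uI mI mf f0 fe.
have mprod : measurable_fun setT (fun w => \prod_(i <- I) f i (Y i w)).
  by apply: measurable_prod => i _; exact: (measurableT_comp (mf i) (mY i)).
under eq_integral do rewrite mulrDl EFinD.
rewrite ge0_integralD//; last 4 first.
- by move=> w _; rewrite lee_fin mulr_ge0// prodr_ge0.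
- by apply/measurable_EFinP; exact: (measurable_funM mZ1 mprod).
- by move=> w _; rewrite lee_fin mulr_ge0// prodr_ge0.
- by apply/measurable_EFinP; exact: (measurable_funM mZ2 mprod).
by rewrite (E1 I f e)// (E2 I f e)// -EFinD mulrDl.
Qed.

Lemma past_expectationM m Z z (g : R -> R) (c : R) :
  past_expectation m Z z ->
  measurable_fun setT g -> (forall x, 0 <= g x) ->
  (\int[nu]_x (g x)%:E = c%:E)%E ->
  past_expectation m.+1 (fun w => Z w * g (Y m w)) (z * c).
Proof.
move=> [mZ Z0 EZ] mg g0 gc; split.
- by apply: measurable_funM => //; exact: (measurableT_comp mg (mY m)).
- by move=> w; rewrite mulr_ge0.
move=> I f e uI mI mf f0 fe.
have mNI : m \notin I by apply/negP => /mI; rewrite ltnn.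
have neqm i : i \in I -> (i == m) = false.
  by move=> iI; apply/negbTE; apply: contraNneq mNI => <-.
(* [g] becomes the test function at index [m], which is free because all indices in [I] exceed
   [m]. *)
have := EZ (m :: I) (fun i => if i == m then g else f i)
  (fun i => if i == m then c else e i).
rewrite big_cons eqxx mulrA [X in z * c * X](_ : _ = \prod_(i <- I) e i); last first.
  by rewrite big_seq [RHS]big_seq; apply: eq_bigr => i /neqm ->.
move=> <-.
- apply: eq_integral => w _; rewrite big_cons eqxx mulrA; congr (_ * _)%:E.
  by rewrite big_seq [RHS]big_seq; apply: eq_bigr => i /neqm ->.
- by rewrite /= mNI.
- by move=> i; rewrite inE => /predU1P[->//|/mI/ltnW].
- by move=> i; case: ifP.
- by move=> i x; case: ifP.
- by move=> i; rewrite inE; case: ifPn => //= _; exact: fe.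
Qed.

End past.

(** * Cluster counts along the sequence of points *)

(** The sum stops at gap m-1, so the count, like X_m, depends only on gaps of index below m. Whether
    X_m itself ends a cluster is decided by gap m and enters at [m.+1]. *)
Definition cluster_count (T : Type) (R : realType) (eps : R) (X : nat -> T -> R)
    (m : nat) (w : T) : nat :=
  (\sum_(0 <= k < m) ((0 < k) && (eps < gap X k w)%R))%N.

Lemma cluster_countS (T : Type) (R : realType) (eps : R) (X : nat -> T -> R) m w :
  cluster_count eps X m.+1 w =
  (cluster_count eps X m w + ((0 < m) && (eps < gap X m w)%R))%N.
Proof. by rewrite /cluster_count big_nat_recr. Qed.

(** * The linear recursion for the expectations *)

Section cluster.
Context d (T : measurableType d) (R : realType) (P : probability T R).
Variables (lam eps : R) (X : nat -> T -> R).
Hypotheses (lam_gt0 : 0 < lam) (eps_gt0 : 0 < eps).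
Hypothesis X_poisson : poisson_process_points P lam X.

Let X0 w : X 0%N w = 0. Proof. by case: X_poisson. Qed.

Lemma point_gap k w : X k.+1 w = X k w + gap X k w.
Proof. by rewrite /gap addrC subrK. Qed.

Lemma measurable_point k : measurable_fun setT (X k).
Proof. by case: X_poisson. Qed.

Lemma measurable_gap k : measurable_fun setT (gap X k).
Proof. by apply: measurable_funB; exact: measurable_point. Qed.

Definition laplace_on_count (s : R) (m n : nat) (w : T) : R :=
  expR (- s * X m w) * (cluster_count eps X m w == n)%:R.

(** Multiplication by the variable on generating functions in n: a gap that ends a cluster raises
    the count by one. *)
Definition shift (V : zmodType) (u : nat -> V) (n : nat) : V :=
  if n is n'.+1 then u n' else 0.

(* The expectation of [laplace_on_count]. *)
Fixpoint laplace_count (s : R) (m : nat) : nat -> R :=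
  if m is m'.+1 then fun n =>
    laplace_count s m' n * tail_weight lam s eps false m' +
    shift (laplace_count s m') n * tail_weight lam s eps true m'
  else fun n => (n == 0%N)%:R.

(** The expected integral of e^(-s x) from X_m + eps to X_(m+1) + eps, on the event that the count
    at [m.+1] is n. At the lower end gap m affects the count but not the exponential, hence the
    weights with parameter 0. *)
Definition laplace_last_point_value (s : R) (m n : nat) : R :=
  expR (- s * eps) / s *
    (laplace_count s m n * tail_weight lam 0 eps false m +
     shift (laplace_count s m) n * tail_weight lam 0 eps true m -
     laplace_count s m.+1 n).

Notation past m := (past_expectation P (gap X) (exponential_measure lam_gt0) m).

(** The event is split according to whether gap m ends a cluster. The separate parameter [t] covers
    two uses: t = s moves the exponential on to X_(m+1), while t = 0 keeps it at X_m and updates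
    only the count. *)
Lemma past_expectation_step (s t : R) m (z : nat -> R) : 0 <= t ->
  (forall n, past m (laplace_on_count s m n) (z n)) ->
  forall n, past m.+1
    (fun w => expR (- t * gap X m w) * expR (- s * X m w) *
              (cluster_count eps X m.+1 w == n)%:R)
    (z n * tail_weight lam t eps false m + shift z n * tail_weight lam t eps true m).
Proof.
move=> t0 Z n; have [_ _ indep dist] := X_poisson.
have Zs : past m (shift (fun k => laplace_on_count s m k) n) (shift z n).
  case: n => [|n]; last exact: Z.
  exact: (past_expectation_cst measurable_gap indep dist m (lexx 0)).
have step j Z' z' : past m Z' z' -> past m.+1
    (fun w => Z' w * tail_kernel t eps j m (gap X m w)) (z' * tail_weight lam t eps j m).
  move=> HZ; apply: past_expectationM => //.
  - exact: measurable_gap.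
  - exact: measurable_tail_kernel.
  - exact: tail_kernel_ge0.
  - exact: integral_tail_kernel.
have := past_expectationD measurable_gap (step false _ _ (Z n)) (step true _ _ Zs).
congr (past _ _ _); apply/funext => w.
rewrite cluster_countS /tail_kernel /laplace_on_count.
case: (_ && _); rewrite /= ?mulr0 ?mulr1 ?addr0 ?add0r ?addn0 ?addn1.
- by case: n {Zs} => [|n] /=; rewrite ?eqSS /=; [rewrite mulr0 mul0r|ring].
- by ring.
Qed.

Lemma past_laplace_on_count s m n : 0 <= s ->
  past m (laplace_on_count s m n) (laplace_count s m n).
Proof.
move=> s0; have [_ _ indep dist] := X_poisson.
elim: m n => [|m IH] n.
  have -> : laplace_on_count s 0 n = cst (n == 0%N)%:R.
    apply/funext => w; rewrite /laplace_on_count X0 mulr0 expR0 mul1r.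
    by rewrite /cluster_count big_geq// eq_sym.
  by apply: (past_expectation_cst measurable_gap indep dist).
have := past_expectation_step s0 IH n.
congr (past _ _ _); apply/funext => w.
by rewrite /laplace_on_count -expRD point_gap; congr (expR _ * _); ring.
Qed.

End cluster.

(** * The count along a single path *)

Section pointwise.
Context (T : Type) (R : realType) (X : nat -> T -> R) (eps : R).

(* Unbounded gaps make the points tend to infinity, and are cheaper to obtain almost
   surely than divergence of their sum. *)
Definition regular_path : set T :=
  [set w | (forall k, 0 <= gap X k w) /\ (forall N, exists k, N%:R < gap X k w)].

(* [X m] is the last point (the origin if m = 0) not exceeding [x - eps]; then
   [n] is the number of cluster ends up to [x]. *)
Definition last_point_event (m n : nat) (x : R) : set T :=
  [set w | [/\ X m w + eps <= x, x < X m.+1 w + eps &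
               cluster_count eps X m.+1 w = n]].

Variable w : T.
Hypotheses (X0 : X 0%N w = 0) (regw : regular_path w).

Lemma regular_nondecreasing : {homo (fun k => X k w) : k l / (k <= l)%N >-> k <= l}.
Proof.
apply: homo_leq => [//|k l h|k]; first exact: le_trans.
by case: regw => /(_ k) + _; rewrite /gap subr_ge0.
Qed.

Lemma regular_ge0 k : 0 <= X k w.
Proof. by rewrite -X0 regular_nondecreasing. Qed.

Lemma regular_last_point_uniq m m' n n' x :
  last_point_event m n x w -> last_point_event m' n' x w -> m = m'.
Proof.
have le_last i j a b : last_point_event i a x w -> last_point_event j b x w -> (i <= j)%N.
  move=> [ix _ _] [_ jx _]; rewrite leqNgt; apply/negP => ji.
  have := le_lt_trans ix jx; rewrite ltrD2r ltNge.
  by rewrite regular_nondecreasing.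
move=> Em Em'; apply/eqP; rewrite eqn_leq.
by rewrite (le_last _ _ _ _ Em Em') (le_last _ _ _ _ Em' Em).
Qed.

Lemma regular_last_point x : eps <= x ->
  exists m, last_point_event m (cluster_count eps X m.+1 w) x w.
Proof.
move=> epsx.
have ex_m : exists m, x < X m.+1 w + eps.
  (* One gap longer than x - eps is enough, since X_k >= 0. *)
  case: regw => _ /(_ (Num.trunc (x - eps)).+1) [k kx]; exists k.
  rewrite -ltrBlDr; apply: lt_trans (truncnS_gt _) _; apply: lt_le_trans kx _.
  by rewrite /gap gerBl regular_ge0.
(* Minimality of m gives X_m + eps <= x; for m = 0 this is the assumption eps <= x. *)
exists (ex_minn ex_m); case: ex_minnP => m xm min_m; split=> //.
case: m xm min_m => [|m] xm min_m; first by rewrite X0 add0r.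
by rewrite leNgt; apply/negP => /min_m; rewrite ltnn.
Qed.

(** On this event X_k + eps <= x amounts to k <= m, so the cluster ends are listed by the filter
    [r]; any other duplicate-free list of them has the same length. *)
Lemma beta0_eq_last_point m c n x :
  last_point_event m c x w -> beta0_eq X eps x n w <-> c = n.
Proof.
move=> [mx xm <-].
pose r := [seq k <- index_iota 0 m.+1 | (0 < k)%N && (eps < gap X k w)].
have r_uniq : uniq r by rewrite filter_uniq// iota_uniq.
have size_r : size r = cluster_count eps X m.+1 w.
  rewrite size_filter -sum1_count big_mkcond; apply: eq_bigr => k _.
  by case: (_ && _).
have memr k : k \in r <-> is_cluster_end_index X eps x w k.
  rewrite mem_filter mem_index_iota; split=> [/andP[/andP[k0 kgap] km]|[k0 kgap kx]].
    split=> //; apply: le_trans mx; rewrite lerD2r.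
    exact: regular_nondecreasing.
  rewrite k0 /gap kgap/= ltnNge; apply/negP => mk.
  have := le_lt_trans kx xm; rewrite ltrD2r ltNge.
  by rewrite regular_nondecreasing.
split=> [[t [t_uniq <- memt]]|<-]; last by exists r.
rewrite -size_r; apply/eqP; rewrite -uniq_size_uniq// => k.
by apply/idP/idP => [/memt/memr|/memr/memt].
Qed.

Lemma beta0_eq_before n x : x < eps -> beta0_eq X eps x n w <-> n = 0%N.
Proof.
move=> xeps; have no_end k : ~ is_cluster_end_index X eps x w k.
  move=> [_ _ kx]; have := le_lt_trans kx xeps; rewrite gtrDr ltNge.
  by rewrite regular_ge0.
split=> [[[|k t] [_ <- memt]]//|->]; last first.
  by exists [::]; split=> // k; split=> // /no_end.
by have /memt/no_end : k \in k :: t by rewrite mem_head.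
Qed.

Lemma last_point_event_before m n x : x < eps -> ~ last_point_event m n x w.
Proof.
move=> xeps [mx _ _]; have := le_lt_trans mx xeps; rewrite gtrDr ltNge.
by rewrite regular_ge0.
Qed.

End pointwise.

(** * Measurability, null sets and the decomposition of the probability *)

Section cluster_probability.
Context d (T : measurableType d) (R : realType) (P : probability T R).
Variables (lam eps : R) (X : nat -> T -> R).
Hypotheses (lam_gt0 : 0 < lam) (eps_gt0 : 0 < eps).
Hypothesis X_poisson : poisson_process_points P lam X.

Let X0 w : X 0%N w = 0. Proof. by case: X_poisson. Qed.
Let mX k : measurable_fun setT (X k). Proof. by case: X_poisson. Qed.

Lemma measurable_cluster_end_index x k :
  measurable [set w | is_cluster_end_index X eps x w k].
Proof.
have [k0|k0] := boolP (1 <= k)%N; last first.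
  rewrite [X in measurable X](_ : _ = set0)//.
  by apply/seteqP; split=> w // []; rewrite (negPf k0).
have -> : [set w | is_cluster_end_index X eps x w k] =
    [set w | eps < gap X k w] `&` [set w | X k w + eps <= x].
  by apply/seteqP; split=> [w []|w []].
apply: measurableI; apply: measurable_set_bool.
- by apply: measurable_fun_ltr => //; exact: (measurable_gap X_poisson).
- by apply: measurable_fun_ler => //; exact: measurable_funD.
Qed.

Lemma measurable_beta0_eq x n : measurable (beta0_eq X eps x n).
Proof.
(* There are countably many lists, and for each list [t] the event that [t] is exactly the set of
   cluster ends is a countable intersection. *)
pose C k := [set w | is_cluster_end_index X eps x w k].
pose F (t : seq nat) := if uniq t && (size t == n) then
  \bigcap_k (if k \in t then C k else ~` C k) else set0.
have -> : beta0_eq X eps x n = \bigcup_t F t.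
  apply/seteqP; split=> [w [t [t_uniq tn memt]]|w [t _]].
    exists t => //; rewrite /F t_uniq tn eqxx => k _.
    by case: ifPn => [/memt//|/negP kt /memt].
  rewrite /F; case: ifPn => // /andP[t_uniq /eqP tn] Ft.
  exists t; split=> // k; have := Ft k I; case: ifPn => // kt; split=> //.
apply: countable_bigcupT_measurable => [|t]; first exact: countableP.
rewrite /F; case: ifP => // _; apply: bigcapT_measurable => k.
by case: ifP => _; [|apply: measurableC]; exact: measurable_cluster_end_index.
Qed.

Lemma measurable_cluster_count m : measurable_fun setT (cluster_count eps X m).
Proof.
elim: m => [|m IH].
  rewrite (_ : cluster_count _ _ _ = cst 0%N)//.
  by apply/funext => w; rewrite /cluster_count big_geq.
rewrite (_ : cluster_count _ _ _ = fun w => cluster_count eps X m w +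
  ((0 < m) && (eps < gap X m w)%R))%N; last by apply/funext => w; rewrite cluster_countS.
apply: measurable_fun_addn => //.
rewrite (_ : (fun w => _) = fun w =>
    if (0 < m)%N && (eps < gap X m w) then 1%N else 0%N); last first.
  by apply/funext => w; case: (_ && _).
apply: measurable_fun_ifT => //; apply: measurable_and => //.
by apply: measurable_fun_ltr => //; exact: (measurable_gap X_poisson).
Qed.

Let mgap k : measurable_fun setT (gap X k). Proof. exact: (measurable_gap X_poisson). Qed.

Lemma gap_lt0_null k : P [set w | gap X k w < 0] = 0%E.
Proof.
have [_ _ _ dist] := X_poisson.
rewrite -[LHS]/(P (gap X k @^-1` [set x | x < 0])) dist; last first.
  by apply: measurable_set_bool; exact: measurable_fun_ltr.
by apply: integral0_eq => x /= x0; rewrite lt0_exponential_pdf.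
Qed.

Import numFieldTopology.Exports numFieldNormedType.Exports.

(** By independence the first m gaps obey the bound with probability p^m, where p < 1, and m is
    arbitrary. The bound is [N.+1] so that it is positive. *)
Lemma bounded_gap_null N : P [set w | forall k, gap X k w <= N.+1%:R] = 0%E.
Proof.
have [_ _ indep dist] := X_poisson.
set S := [set w | _].
have mle : measurable [set x : R | x <= N.+1%:R].
  by apply: measurable_set_bool; exact: measurable_fun_ler.
have mgap_le k : measurable (gap X k @^-1` [set x | x <= N.+1%:R]).
  by rewrite -[X in measurable X]setTI; exact: mgap.
have mS : measurable S.
  rewrite (_ : S = \bigcap_k (gap X k @^-1` [set x | x <= N.+1%:R])).
    exact: bigcapT_measurable.
  by apply/seteqP; split=> [w Sw k _|w Sw k]; [exact: Sw|exact: (Sw k I)].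
pose p : R := 1 - expR (- lam * N.+1%:R).
pose B m := \bigcap_(j in [set j | j \in index_iota 0 m])
  (gap X j @^-1` [set x | x <= N.+1%:R]).
have PB m : P (B m) = (p ^+ m)%:E.
  rewrite /B (prob_bigcap_indep (nu := exponential_measure lam_gt0) indep dist
    (iota_uniq 0 (m - 0)) (fun=> mle)).
  under eq_bigr do rewrite exponential_measure_le//.
  by rewrite prodEFin prodr_const_nat subn0.
have PS m : fine (P S) <= p ^+ m.
  rewrite -lee_fin fineK ?fin_num_measure// -PB; apply: le_measure; rewrite ?inE//.
    by apply: bigcap_measurableType => j _.
  by move=> w Sw j _; exact: Sw.
have p1 : `|p| < 1.
  rewrite /p ger0_norm ?subr_ge0; first by rewrite gtrBl expR_gt0.
  by rewrite -expR0 ler_expR mulNr oppr_le0 mulr_ge0// ltW.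
have /limr_ge : cvg ((fun m => p ^+ m) @ \oo) by apply: cvgP; exact: cvg_expr p1.
move=> /(_ _ (nearW _ PS)); rewrite (cvg_lim _ (cvg_expr p1))// => PS0.
have : (P S <= 0)%E by rewrite -[P S]fineK ?fin_num_measure// lee_fin.
by rewrite measure_le0 => /eqP.
Qed.

(** Joint measurability in the path and x, for Tonelli. *)
Lemma measurable_last_point_graph m n :
  measurable [set z : T * measurableTypeR R | last_point_event X eps m n z.2 z.1].
Proof.
have mX1 k : measurable_fun setT (fun z : T * measurableTypeR R => X k z.1 + eps).
  by apply: measurable_funD => //; exact: (measurableT_comp (mX k) measurable_fst).
have -> : [set z : T * measurableTypeR R | last_point_event X eps m n z.2 z.1] =
    [set z | X m z.1 + eps <= z.2] `&` [set z | z.2 < X m.+1 z.1 + eps] `&`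
    [set z | cluster_count eps X m.+1 z.1 == n].
  by apply/seteqP; split=> [z [? ? /eqP]|z [[? ?] /eqP]].
apply: measurableI; first apply: measurableI.
- apply: (@measurable_set_bool _ (T * measurableTypeR R)%type).
  by apply: measurable_fun_ler; [exact: mX1|exact: measurable_snd].
- apply: (@measurable_set_bool _ (T * measurableTypeR R)%type).
  by apply: measurable_fun_ltr; [exact: measurable_snd|exact: mX1].
- apply: (@measurable_set_bool _ (T * measurableTypeR R)%type).
  apply: measurable_fun_eqn => //.
  exact: (measurableT_comp (measurable_cluster_count m.+1) measurable_fst).
Qed.

Lemma measurable_last_point_event m n x : measurable (last_point_event X eps m n x).
Proof.
have -> : last_point_event X eps m n x =
    [set w | X m w + eps <= x] `&` [set w | x < X m.+1 w + eps] `&`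
    [set w | cluster_count eps X m.+1 w == n].
  by apply/seteqP; split=> [z [? ? /eqP]|z [[? ?] /eqP]].
apply: measurableI; first apply: measurableI; apply: measurable_set_bool.
- by apply: measurable_fun_ler => //; exact: measurable_funD.
- by apply: measurable_fun_ltr => //; exact: measurable_funD.
- by apply: measurable_fun_eqn => //; exact: measurable_cluster_count.
Qed.

Lemma irregular_path_null :
  exists N, [/\ measurable N, P N = 0%E & ~` regular_path X `<=` N].
Proof.
have neg_gap k : P.-negligible [set w | gap X k w < 0].
  apply/negligibleP; last exact: gap_lt0_null.
  by apply: measurable_set_bool; exact: measurable_fun_ltr.
have bounded_gap N : P.-negligible [set w | forall k, gap X k w <= N.+1%:R].
  apply/negligibleP; last exact: bounded_gap_null.
  rewrite (_ : [set w | _] = \bigcap_k [set w | gap X k w <= N.+1%:R]).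
    apply: bigcapT_measurable => k; apply: measurable_set_bool.
    exact: measurable_fun_ler.
  by apply/seteqP; split=> [w Sw k _|w Sw k]; [exact: Sw|exact: (Sw k I)].
have [N [mN N0 sub]] :=
  negligibleU (negligible_bigcup neg_gap) (negligible_bigcup bounded_gap).
exists N; split=> //; apply: subset_trans sub => w irr_w.
apply: contrapT => /not_orP[gap0 unb]; apply: irr_w; split=> [k|n].
  by rewrite leNgt; apply/negP => kw; apply: gap0; exists k.
apply: contrapT => /forallNP bnd; apply: unb; exists n => // k /=.
apply: (@le_trans _ _ n%:R); last by rewrite ler_nat.
by rewrite leNgt; apply/negP; exact: bnd.
Qed.

(** A null set containing the irregular paths is removed from every event. On what remains, no
    cluster is complete if x < eps; otherwise the last-point events with count n are disjoint and
    their union is the event on the left. *)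
Lemma prob_beta0_eq n x : P (beta0_eq X eps x n) =
  ((((n == 0%N) && (x < eps))%:R)%:E +
   \sum_(m <oo) P (last_point_event X eps m n x))%E.
Proof.
have [N [mN N0 irrN]] := irregular_path_null.
have reg w : ~ N w -> regular_path X w.
  by move=> Nw; apply: contrapT => /irrN.
have mL m := measurable_last_point_event m n x.
have drop A : measurable A -> P A = P (A `\` N) by move=> mA; exact: measure_setD_null.
rewrite (drop _ (measurable_beta0_eq x n)).
under eq_eseriesr do rewrite (drop _ (mL _)).
have [xeps|epsx] := ltP x eps.
  rewrite eseries0 ?adde0; last first.
    move=> m _ _; rewrite (_ : _ `\` _ = set0) ?measure0//.
    apply/seteqP; split=> w // -[Lw Nw].
    exact: (last_point_event_before (X0 w) (reg w Nw) xeps Lw).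
  rewrite andbT; case: eqP => n0.
    rewrite -[RHS](@probability_setT _ _ _ P) [RHS](drop _ measurableT); congr (P _).
    apply/seteqP; split=> w [_ Nw]; split=> //.
    exact/(beta0_eq_before (X0 w) (reg w Nw) n xeps).
  rewrite (_ : _ `\` _ = set0) ?measure0//.
  apply/seteqP; split=> w // -[bw Nw].
  by apply: n0; exact/(beta0_eq_before (X0 w) (reg w Nw) n xeps).
rewrite andbF add0e -measure_semi_bigcup.
- congr (P _); apply/seteqP; split=> [w [bw Nw]|w [m _ [Lw Nw]]].
    have [m Lw] := regular_last_point (X0 w) (reg w Nw) epsx.
    have cn := (beta0_eq_last_point (reg w Nw) n Lw).1 bw.
    by exists m => //; split=> //; rewrite -cn.
  by split=> //; exact/(beta0_eq_last_point (reg w Nw) n Lw).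
- by move=> m; exact: measurableD.
- move=> i j _ _ [w [[Li Ni] [Lj _]]].
  exact: (regular_last_point_uniq (reg w Ni) Li Lj).
- by apply: bigcupT_measurable => m; exact: measurableD.
Qed.

End cluster_probability.

(** * Laplace transforms *)

Section expR_interval.
Import numFieldTopology.Exports numFieldNormedType.Exports.

Lemma integral_expR_itv (R : realType) (s a b : R) : 0 < s -> a <= b ->
  (\int[lebesgue_measure]_(x in `[a, b[) (expR (- s * x))%:E =
   ((expR (- s * a) - expR (- s * b)) / s)%:E)%E.
Proof.
move=> s0; rewrite le_eqVlt => /predU1P[->|ab].
  by rewrite set_itvco0 ?lexx// integral_set0 subrr mul0r.
have cexp : continuous (fun x : R^o => expR (- s * x)).
  move=> x; apply: continuous_comp; last exact: continuous_expR.
  exact: mulrl_continuous.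
have mexp : measurable_fun setT (fun x : R => expR (- s * x)) by exact: measurable_expRM.
have cf : continuous (fun x : R^o => s * expR (- s * x)).
  move=> x; apply: (@continuous_comp _ _ _ (fun x : R^o => expR (- s * x)) ( *%R s)).
    exact: cexp.
  exact: mulrl_continuous.
rewrite integral_itv_bndo_bndc; last exact/measurable_EFinP/measurable_funTS.
(* The factor s makes -e^(-s x) an antiderivative; it is divided out at the end. *)
have : (\int[lebesgue_measure]_(x in `[a, b]) (s * expR (- s * x))%:E =
    (- expR (- s * b))%:E - (- expR (- s * a))%:E)%E.
  apply: (continuous_FTC2 (F := fun x => - expR (- s * x)) ab).
  - exact: continuous_subspaceT.
  - split.
    + by move=> x _; exact: ex_derive.
    + by apply: cvg_at_right_filter; apply: cvgN; exact: cexp.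
    + by apply: cvg_at_left_filter; apply: cvgN; exact: cexp.
  - move=> x _; rewrite derive1_comp// derive1N// derive1_id mulN1r.
    rewrite derive1_comp// derive1E.
    have /funeqP -> := @derive_expR R.
    by rewrite derive1Ml// derive1_id mulr1 mulrN opprK mulrC.
under eq_integral do rewrite EFinM.
rewrite ge0_integralZl//; last 2 first.
- exact/measurable_EFinP/measurable_funTS.
- by rewrite lee_fin ltW.
move=> /(congr1 (fun y => (s^-1)%:E * y)%E).
rewrite muleA -EFinM mulVf ?gt_eqF// mul1e => ->.
by rewrite -EFinB -EFinM; congr EFin; ring.
Qed.

End expR_interval.

(** * Transforms of the last-point probabilities *)

Section last_point_laplace.
Context d (T : measurableType d) (R : realType) (P : probability T R).
Variables (lam eps s : R) (X : nat -> T -> R).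
Hypotheses (lam_gt0 : 0 < lam) (eps_gt0 : 0 < eps) (s_gt0 : 0 < s).
Hypothesis X_poisson : poisson_process_points P lam X.

Let X0 w : X 0%N w = 0. Proof. by case: X_poisson. Qed.

Notation leb := (@lebesgue_measure R).

Let integrand m n (z : T * measurableTypeR R) : \bar R :=
  (expR (- s * z.2) * \1_`[0, +oo[ z.2 *
   \1_[set z : T * measurableTypeR R | last_point_event X eps m n z.2 z.1] z)%:E.

Let integrand_ge0 m n z : (0 <= integrand m n z)%E.
Proof. by rewrite lee_fin !mulr_ge0// expR_ge0. Qed.

Let measurable_integrand m n : measurable_fun setT (integrand m n).
Proof.
apply/measurable_EFinP; apply: measurable_funM; first apply: measurable_funM.
- exact: (measurableT_comp (measurable_expRM (- s)) measurable_snd).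
- have mI : measurable_fun setT (\1_`[0, +oo[ : R -> R) by exact: measurable_indic.
  exact: (measurableT_comp mI measurable_snd).
- apply: (@measurable_indic _ (T * measurableTypeR R)%type).
  exact: (measurable_last_point_graph eps X_poisson m n).
Qed.

(** If the count is n, the section is the interval from X_m + eps to X_(m+1) + eps, which lies in
    the half-line because X_m >= 0. *)
Let integrand_section m n w : regular_path X w ->
  (\int[leb]_x integrand m n (w, x) =
   ((expR (- s * (X m w + eps)) - expR (- s * (X m.+1 w + eps))) / s *
    (cluster_count eps X m.+1 w == n)%:R)%:E)%E.
Proof.
move=> regw.
have [cn|cn] := eqVneq (cluster_count eps X m.+1 w) n; last first.
  rewrite mulr0; apply: integral0_eq => x _; rewrite /integrand /=.
  by rewrite [X in _ * X]indicE memNset ?mulr0//= => -[_ _ /eqP]; rewrite (negPf cn).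
rewrite mulr1 -integral_expR_itv//; last first.
  by rewrite lerD2r (regular_nondecreasing regw).
rewrite [RHS]integral_mkcond; apply: eq_integral => x _; rewrite patchE /integrand /=.
case: ifPn.
  rewrite inE/= in_itv/= => /andP[mx xm].
  rewrite !indicE !mem_set ?mulr1//=.
  rewrite in_itv/= andbT; apply: le_trans mx.
  by rewrite addr_ge0 ?(regular_ge0 (X0 w) regw)// ltW.
rewrite notin_setE/= in_itv/= => xI.
rewrite [X in _ * X]indicE memNset ?mulr0//= => -[mx xm _].
by apply: xI; rewrite mx xm.
Qed.

Lemma laplace_last_point m n :
  (\int[leb]_(x in `[0%R, +oo[) ((expR (- s * x))%:E * P (last_point_event X eps m n x)) =
   (laplace_last_point_value lam eps s m n)%:E)%E.
Proof.
rewrite /laplace_last_point_value.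
pose c := expR (- s * eps) / s.
have c0 : 0 <= c by rewrite divr_ge0 ?expR_ge0 ?ltW.
have past_u := past_laplace_on_count lam_gt0 eps_gt0 X_poisson.
(* The contribution of the lower end of the interval; the trivial factor gives it the form of
   [past_expectation_step] at t = 0. *)
pose g w := expR (- 0 * gap X m w) * expR (- s * X m w) *
              (cluster_count eps X m.+1 w == n)%:R.
have past_g := past_expectation_step eps_gt0 X_poisson (lexx 0)
  (fun k => past_u s m k (ltW s_gt0)) n.
have int_g := past_expectation_integral past_g; rewrite -/g in int_g.
have [mg g0 _] := past_g.
have [mu u0 _] := past_u s m.+1 n (ltW s_gt0).
have int_u := past_expectation_integral (past_u s m.+1 n (ltW s_gt0)).
set z := (_ + _) in int_g *; set v := laplace_count _ _ _ m.+1 n in int_u *.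
transitivity (\int[leb]_x \int[P]_w integrand m n (w, x))%E.
  rewrite integral_mkcond; apply: eq_integral => x _; rewrite patchE.
  case: ifPn => x0; last first.
    apply/esym/integral0_eq => w _; rewrite /integrand/=.
    by rewrite [X in _ * X * _]indicE (negPf x0) mulr0 mul0r.
  rewrite -[X in (_ * P X)%E]setIT -integral_indic//; last first.
    exact: (measurable_last_point_event eps X_poisson).
  rewrite -ge0_integralZl//; last first.
    apply/measurable_EFinP/measurable_indic.
    exact: (measurable_last_point_event eps X_poisson).
  apply: eq_integral => w _; rewrite /integrand/= -EFinM !indicE x0 mulr1.
  congr (_ * (nat_of_bool _)%:R)%:E.
rewrite -(fubini_tonelli (m1 := P) (m2 := leb) (integrand m n))//.
pose F w := (\int[leb]_x integrand m n (w, x))%E.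
have mF : measurable_fun setT F.
  exact: (measurable_fun_fubini_tonelli_F (integrand m n)).
have F0 w : (0 <= F w)%E by exact: integral_ge0.
(* Stated additively: all terms are nonnegative, so no integrability is needed. *)
have : (\int[P]_w (F w + c%:E * (laplace_on_count eps X s m.+1 n w)%:E) =
        \int[P]_w (c%:E * (g w)%:E))%E.
  apply: ge0_ae_eq_integral => //.
  - apply: emeasurable_funD => //; apply: measurable_funeM; exact/measurable_EFinP.
  - by apply: measurable_funeM; exact/measurable_EFinP.
  - by move=> w _; rewrite adde_ge0// mule_ge0// lee_fin.
  - by move=> w _; rewrite -EFinM lee_fin mulr_ge0//; exact: g0.
  have [N [mN N0 irrN]] := irregular_path_null lam_gt0 X_poisson.
  exists N; split=> //; apply: subset_trans irrN => w /= bad regw; apply: bad => _.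
  rewrite /F integrand_section// -!EFinM -EFinD /g /laplace_on_count /c; congr EFin.
  by rewrite oppr0 mul0r expR0 mul1r !mulrDr !expRD; field; rewrite gt_eqF.
rewrite ge0_integralD//; last 2 first.
- by move=> w _; rewrite mule_ge0// lee_fin.
- by apply: measurable_funeM; exact/measurable_EFinP.
rewrite !ge0_integralZl//; do ?by exact/measurable_EFinP.
2,3: by move=> w _; rewrite lee_fin; first [exact: g0|exact: u0].
rewrite int_u int_g -!EFinM => FE.
by rewrite -[LHS](@addeK _ (c * v)%:E)// FE -EFinB mulrBr.
Qed.

End last_point_laplace.

(** * Convergence of a monotone affine recursion *)

Section recursion.
Import numFieldTopology.Exports numFieldNormedType.Exports.
Context (R : realType).

(** Induction on n: once the limit at n-1 is known, the limit at n solves the same affine equation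
    as [V n], and c < 1 makes the solution unique. *)
Lemma affine_recursion_cvg (x : nat -> nat -> R) (a V : nat -> R) (b c : R) :
  (forall n, 0 <= a n) -> 0 <= b -> 0 <= c -> c < 1 ->
  (forall n, x 0%N n = 0) -> (forall n, 0 <= V n) ->
  (forall M n, x M.+1 n = a n + c * x M n + b * shift (x M) n) ->
  (forall n, V n = a n + c * V n + b * shift V n) ->
  forall n, (x ^~ n) @ \oo --> V n.
Proof.
move=> a0 b0 c0 c1 x0 V0 xS VE.
have shift_le (u v : nat -> R) :
    (forall n, u n <= v n) -> forall n, shift u n <= shift v n.
  by move=> uv [|n] /=.
(* The iterates increase and stay below the fixed point [V]. *)
have x_nd n : nondecreasing_seq (x ^~ n).
  apply/nondecreasing_seqP => M; elim: M n => [|M IH] n.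
    rewrite x0 xS x0 mulr0 addr0 addr_ge0// mulr_ge0//.
    by case: n => [|n] //=; rewrite x0.
  rewrite [leLHS]xS [leRHS]xS.
  by apply: lerD; [apply: lerD => //|]; rewrite ler_wpM2l// shift_le.
have x_le M n : x M n <= V n.
  elim: M n => [|M IH] n; first by rewrite x0.
  by rewrite xS VE; apply: lerD; [apply: lerD => //|]; rewrite ler_wpM2l// shift_le.
have x_cvg n : cvg (x ^~ n @ \oo).
  apply: nondecreasing_is_cvgn; first exact: x_nd.
  by exists (V n) => _ [M _ <-].
have step n : (fun M => shift (x M) n) @ \oo --> shift V n -> x ^~ n @ \oo --> V n.
  move=> xsV; pose l := limn (x ^~ n).
  have xl : x ^~ n @ \oo --> l by exact: x_cvg.
  have xSl : (fun M => x M.+1 n) @ \oo --> l by rewrite (cvg_shiftS (x ^~ n)).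
  have xSa : (fun M => x M.+1 n) @ \oo --> a n + c * l + b * shift V n.
    under eq_fun do rewrite xS.
    by apply: cvgD; [apply: cvgD; [exact: cvg_cst|exact: cvgMr]|exact: cvgMr].
  have le : l = a n + c * l + b * shift V n.
    by rewrite -(cvg_lim _ xSa)// (cvg_lim _ xSl).
  suff -> : V n = l by [].
  have : (1 - c) * (V n - l) = 0 by have := VE n; move: le; lra.
  by move=> /eqP; rewrite mulf_eq0 !subr_eq0 gt_eqF//= => /eqP.
by elim => [|n IH]; apply: step => //=; exact: cvg_cst.
Qed.
End recursion.

(** * Summation over the index of the last point *)

Section summation.
Import numFieldTopology.Exports numFieldNormedType.Exports.
Context (R : realType) (lam eps s : R).
Hypotheses (lam_gt0 : 0 < lam) (eps_gt0 : 0 < eps) (s_gt0 : 0 < s).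

Let K := expR ((lam + s) * eps).
Let rho := lam / (s * K + lam).

Let KE : K = expR (lam * eps) * expR (s * eps).
Proof. by rewrite -expRD -mulrDl. Qed.

Let K_gt1 : 1 < K.
Proof. by rewrite -expR0 ltr_expR mulr_gt0// addr_gt0. Qed.

Let tail_s : expR (- (lam + s) * eps) = K^-1.
Proof. by rewrite mulNr expRN. Qed.

Let tail_0 : expR (- (lam + 0) * eps) = expR (s * eps) / K.
Proof. by rewrite addr0 mulNr expRN KE; field; rewrite !gt_eqF ?expR_gt0. Qed.

Notation laplace_count := (laplace_count lam eps s).
Notation laplace_last_point_value := (laplace_last_point_value lam eps s).

Let ls0 : lam + s != 0. Proof. by rewrite gt_eqF// addr_gt0. Qed.
Let sK0 : s * K + lam != 0.
Proof. by rewrite gt_eqF// addr_gt0// mulr_gt0// (lt_trans _ K_gt1). Qed.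
Let K0 : K != 0. Proof. by rewrite gt_eqF// (lt_trans _ K_gt1). Qed.
Let E20 : expR (s * eps) != 0. Proof. by rewrite gt_eqF// expR_gt0. Qed.
Let s0 : s != 0. Proof. by rewrite gt_eqF. Qed.
Let lam0 : lam != 0. Proof. by rewrite gt_eqF. Qed.

Let tail_weightS t j m : tail_weight lam t eps j m.+1 =
  lam / (lam + t) *
  (if j then expR (- (lam + t) * eps) else 1 - expR (- (lam + t) * eps)).
Proof. by rewrite /tail_weight /= mul1r. Qed.

Lemma laplace_countS m n : laplace_count m.+1 n =
  laplace_count m n * tail_weight lam s eps false m +
  shift (laplace_count m) n * tail_weight lam s eps true m.
Proof. by []. Qed.

Lemma laplace_count1 n : laplace_count 1 n = lam / (lam + s) * (n == 0%N)%:R.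
Proof. by rewrite /= /tail_weight/= !mul0r mulr0 subr0 mulr1 !mulr0 addr0 mulrC. Qed.

(** The weights are constant from index 1 on, so the sum starts with [laplace_count 1], which is the
    inhomogeneous term [a]. The fixed point is geometric: (1 - c) V_0 = lam / (lam + s) gives V_0 =
    K rho, and the ratio b / (1 - c) is rho. *)
Lemma laplace_count_series n :
  (fun M => \sum_(0 <= m < M) laplace_count m.+1 n) @ \oo --> K * rho ^+ n.+1.
Proof.
have q_le1 : K^-1 <= 1 by rewrite invf_le1 ?ltW// (lt_trans _ K_gt1).
have q_gt0 : 0 < K^-1 by rewrite invr_gt0 (lt_trans _ K_gt1).
have a_gt0 : 0 < lam / (lam + s) by rewrite divr_gt0// addr_gt0.
have a_lt1 : lam / (lam + s) < 1 by rewrite ltr_pdivrMr ?mul1r ?ltrDl// addr_gt0.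
have rho_ge0 : 0 <= rho.
  by rewrite divr_ge0 ?ltW// addr_gt0// mulr_gt0// (lt_trans _ K_gt1).
apply: (affine_recursion_cvg (x := fun M n => \sum_(0 <= m < M) laplace_count m.+1 n)
  (a := fun n => lam / (lam + s) * (n == 0%N)%:R)
  (V := fun n => K * rho ^+ n.+1)
  (c := lam / (lam + s) * (1 - K^-1)) (b := lam / (lam + s) * K^-1)) => {n}.
- by move=> n; rewrite mulr_ge0// ltW.
- by rewrite mulr_ge0 ?ltW.
- by rewrite mulr_ge0 ?subr_ge0// ltW.
- apply: le_lt_trans a_lt1; rewrite ler_piMr ?(ltW a_gt0)//.
  by rewrite gerBl ltW.
- by move=> n; rewrite big_geq.
- by move=> n; rewrite mulr_ge0 ?exprn_ge0// ltW// (lt_trans _ K_gt1).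
- move=> M n; rewrite big_nat_recl// laplace_count1 -addrA; congr (_ + _).
  have -> : shift (fun n => \sum_(0 <= m < M) laplace_count m.+1 n) n =
      \sum_(0 <= m < M) shift (laplace_count m.+1) n.
    by case: n => [|n] //=; rewrite big1.
  rewrite !mulr_sumr -big_split; apply: eq_bigr => m _.
  rewrite [laplace_count m.+2 n]laplace_countS !tail_weightS tail_s.
  by congr (_ + _); exact: mulrC.
- move=> [|n]; rewrite /= ?exprS ?expr0 /rho.
    by field; rewrite ?K0 ?ls0 ?sK0.
  by field; rewrite ?K0 ?ls0 ?sK0.
Qed.

(** The subtracted term, present only for n = 0, is the transform of the part x < eps, during which
    no last-point event occurs. *)
Lemma laplace_last_point_series n :
  (fun M => \sum_(0 <= m < M) laplace_last_point_value m n) @ \oo -->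
  lam ^+ n * K / (s * K + lam) ^+ n.+1 -
  (n == 0%N)%:R * ((1 - expR (- s * eps)) / s).
Proof.
set k := expR (- s * eps) / s.
have kE : k = (expR (s * eps) * s)^-1 by rewrite /k mulNr expRN invfM.
set S := fun n M => \sum_(0 <= m < M) laplace_count m.+1 n.
(* [p] and [q] are the weights at parameter 0 minus those at parameter s, for a gap <= eps and > eps
   respectively. They hold for m >= 1, so the term m = 0 is split off. *)
set p := 1 - expR (s * eps) / K - lam / (lam + s) * (1 - K^-1).
set q := expR (s * eps) / K - lam / (lam + s) * K^-1.
rewrite -(cvg_shiftS (fun M => \sum_(0 <= m < M) laplace_last_point_value m n)) /=.
have -> : (fun M => \sum_(0 <= m < M.+1) laplace_last_point_value m n) =
    fun M => k * ((n == 0%N)%:R * (1 - lam / (lam + s)) +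
      (p * S n M + q * shift (fun n => S n M) n)).
  apply/funext => M; rewrite big_nat_recl//.
  have -> : shift (fun n => S n M) n = \sum_(0 <= m < M) shift (laplace_count m.+1) n.
    by case: n => [|n] //=; rewrite big1.
  rewrite [RHS]mulrDr; congr (_ + _).
    rewrite /laplace_last_point_value laplace_count1 /tail_weight /= !mul0r subr0.
    by rewrite addr0 divff// /k; ring.
  rewrite /S !mulr_sumr -big_split mulr_sumr; apply: eq_bigr => m _.
  rewrite /laplace_last_point_value -/k [laplace_count m.+2 n]laplace_countS.
  rewrite !tail_weightS tail_0 tail_s addr0 divff//.
  by move: (laplace_count m.+1) => u /=; rewrite /p /q; ring.
have -> : lam ^+ n * K / (s * K + lam) ^+ n.+1 -
    (n == 0%N)%:R * ((1 - expR (- s * eps)) / s) =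
    k * ((n == 0%N)%:R * (1 - lam / (lam + s)) +
      (p * (K * rho ^+ n.+1) + q * shift (fun n => K * rho ^+ n.+1) n)).
  rewrite kE mulNr expRN /p /q /rho; case: n => [|n] /=.
    by rewrite expr1 expr0; field; rewrite ?K0 ?ls0 ?sK0 ?E20 ?s0.
  have -> : lam ^+ n.+1 * K / (s * K + lam) ^+ n.+2 =
      (lam / (s * K + lam)) ^+ n.+1 * K / (s * K + lam).
    by rewrite expr_div_n [_ ^+ n.+2]exprSr; field; rewrite sK0 expf_neq0.
  rewrite !(exprS _ n.+1) mul0r subr0 mul0r add0r.
  by field; rewrite ?K0 ?ls0 ?sK0 ?E20 ?s0.
apply: cvgMr; apply: cvgD; first exact: cvg_cst.
apply: cvgD; apply: cvgMr; first exact: laplace_count_series.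
case: n => [|n]; first exact: cvg_cst.
exact: laplace_count_series.
Qed.

End summation.

Lemma measurable_prob_last_point (d : measure_display) (T : measurableType d)
    (R : realType) (P : probability T R) (lam eps : R) (X : nat -> T -> R) m n :
  poisson_process_points P lam X ->
  measurable_fun [set: measurableTypeR R] (fun x => P (last_point_event X eps m n x)).
Proof.
move=> X_poisson.
have := measurable_fun_ysection P (measurable_last_point_graph eps X_poisson m n).
congr measurable_fun; apply/funext => x /=; congr (P _).
by apply/seteqP; split=> w; rewrite /ysection/=; [move/set_mem|move=> Lw; apply/mem_set].
Qed.

Lemma laplace_before_eps (R : realType) (eps s : R) (n : nat) : 0 < eps -> 0 < s ->
  (\int[lebesgue_measure]_(x in `[0%R, +oo[)
     ((expR (- s * x))%:E * (((n == 0%N) && (x < eps))%:R)%:E) =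
   ((n == 0%N)%:R * ((1 - expR (- s * eps)) / s))%:E)%E.
Proof.
move=> eps0 s0; case: eqP => _ /=; last first.
  by rewrite mul0r; apply: integral0_eq => x _; rewrite mule0.
have -> : 1%:R * ((1 - expR (- s * eps)) / s) = (expR (- s * 0) - expR (- s * eps)) / s.
  by rewrite mul1r mulr0 expR0.
rewrite -integral_expR_itv ?ltW// [LHS]integral_mkcond [RHS]integral_mkcond.
apply: eq_integral => x _; rewrite !patchE.
have -> : (x \in `[0, eps[%classic) = (x \in `[0, +oo[%classic) && (x < eps).
  apply/idP/andP => [/set_mem|[/set_mem]]; rewrite /= !in_itv/= ?andbT.
    by move=> /andP[x0 xe]; split=> //; apply/mem_set; rewrite /= in_itv/= x0.
  by move=> x0 xe; apply/mem_set; rewrite /= in_itv/= x0.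
by case: (x \in _) => //=; case: (x < eps); rewrite ?mule1 ?mule0.
Qed.

Theorem theorem2 (d : measure_display) (T : measurableType d) (R : realType)
    (P : probability T R) (lam eps : R) (X : nat -> T -> R) :
  0 < lam -> 0 < eps -> poisson_process_points P lam X ->
  forall (n : nat) (s : R), 0 < s ->
  (\int[lebesgue_measure]_(x in `[0%R, +oo[%classic)
      ((expR (- s * x))%:E * P (beta0_eq X eps x n)))%E =
  ((lam ^+ n * expR ((lam + s) * eps)) /
     (s * expR ((lam + s) * eps) + lam) ^+ n.+1)%:E.
Proof.
move=> lam0 eps0 X_poisson n s s0.
pose D : set (measurableTypeR R) := `[0%R, +oo[%classic.
have mexp : measurable_fun D (fun x : R => (expR (- s * x))%:E).
  by apply/measurable_EFinP/measurable_funTS; exact: measurable_expRM.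
have mP m : measurable_fun D
    (fun x => (expR (- s * x))%:E * P (last_point_event X eps m n x))%E.
  apply: emeasurable_funM => //; apply: measurable_funTS.
  exact: measurable_prob_last_point X_poisson.
have mbefore : measurable_fun D
    (fun x : R => (expR (- s * x))%:E * (((n == 0%N) && (x < eps))%:R)%:E)%E.
  apply: emeasurable_funM => //; apply/measurable_EFinP/measurable_funTS.
  apply: measurable_natr_bool; apply: measurable_and => //.
  exact: measurable_fun_ltr.
under eq_integral => x _.
  rewrite (prob_beta0_eq eps lam0 X_poisson) ge0_muleDr//; last exact: nneseries_ge0.
  rewrite -nneseriesZl//.
  over.
rewrite ge0_integralD//; last 2 first.
- by move=> x _; apply: nneseries_ge0 => m _ _; rewrite mule_ge0// lee_fin expR_ge0.
- by apply: ge0_emeasurable_sum => // m x _ _; rewrite mule_ge0// lee_fin expR_ge0.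
rewrite laplace_before_eps// integral_nneseries//; last first.
  by move=> m x _; rewrite mule_ge0// lee_fin expR_ge0.
under eq_eseriesr do rewrite (laplace_last_point lam0 eps0 s0 X_poisson).
(* [b] comes from x < eps and cancels the term subtracted in the limit of the series. *)
set b := _ * (_ / s).
rewrite (_ : (\sum_(_ <oo) _)%E = (lam ^+ n * expR ((lam + s) * eps) /
    (s * expR ((lam + s) * eps) + lam) ^+ n.+1 - b)%:E); last first.
  apply/cvg_lim => //; under eq_fun do rewrite sumEFin.
  apply: cvg_EFin; first exact: nearW.
  exact: laplace_last_point_series.
by rewrite -EFinD addrC subrK.
Qed.
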